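(* Let $\mathcal{F}$ be a family of payoff functions on $\mathbb{R}^n$ and assume that $X_1,\dots,X_m$ are independent darts taking values in $\mathbb{R}^n$, each of which belongs to $\mathcal{X}_{\mathcal{F}}$. If $\mathcal{F}$ is any of the following sets: (1) the set of all payoff functions; (2) the set of all continuous payoff functions; (3) the set of all bounded payoff functions; (4) the set of all bounded continuous payoff functions; (5) the set of all payoff functions of the same type as $\cos\big(\sum_{j=1}^n x_j\big)$, then for any $d_1,\dots,d_m,D_1,\dots,D_m\ge 0$ such that $d_j\le D_j$ for all $j$ we have $$\sup_{a\in\mathbb{R}^n} Ef\Big(a+\sum_{j=1}^m d_jX_j\Big)\ \ge\ \sup_{a\in\mathbb{R}^n} Ef\Big(a+\sum_{j=1}^m D_jX_j\Big)\qquad\text{for all } f\in\mathcal{F},$$ and in particular $\sum_{j=1}^m X_j\in\mathcal{X}_{\mathcal{F}}$.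
   Context: A dart is a random vector $X$ taking values in $\mathbb{R}^n$. A payoff function is a measurable function $f:\mathbb{R}^n\to\mathbb{R}$ which is bounded from above (so expectations exist in $[-\infty,\infty)$). For $d>0$, $g_{X,f}(d):=\sup_{a\in\mathbb{R}^n}Ef(a+dX)$. The pair $(X,f)$ is reasonable if $g_{X,f}(d)$ is decreasing (i.e. non-increasing) in $d\in(0,\infty)$. $X$ is reasonable with respect to a family $\mathcal{F}$ of payoff functions if $(X,f)$ is reasonable for all $f\in\mathcal{F}$; $\mathcal{X}_{\mathcal{F}}$ denotes the set of darts which are reasonable with respect to $\mathcal{F}$. Functions $f$ and $h$ on $\mathbb{R}^n$ have the same type if there exist $a,c>0$, $b\in\mathbb{R}^n$ and $d\in\mathbb{R}$ such that $h(x)=cf(ax+b)+d$ for all $x$. *)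

(* Defs.v *)
From HB Require Import structures.
From mathcomp Require Import all_boot all_order all_algebra.
From mathcomp Require Import all_classical all_reals all_analysis.

Set Implicit Arguments.
Unset Strict Implicit.
Unset Printing Implicit Defensive.

Import Order.TTheory GRing.Theory Num.Theory.
Import numFieldNormedType.Exports.

Local Open Scope classical_set_scope.
Local Open Scope ring_scope.

(* The library puts no measurable structure on matrices; row vectors get the
   Borel sigma-algebra of their (product) topology. *)
HB.instance Definition _ (R : realType) (n : nat) :=
  @isMeasurable.Build (sigma_display (@open 'rV[R]_n)) 'rV[R]_n
    <<s @open 'rV[R]_n >> (@sigma_algebra0 _ setT (@open 'rV[R]_n))
    (@sigma_algebraC _ (@open 'rV[R]_n))
    (@sigma_algebra_bigcup _ setT (@open 'rV[R]_n)).

Section payoffs.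
Context (R : realType) (n : nat).
Implicit Types f h : 'rV[R]_n -> R.

Definition payoff f : Prop :=
  measurable_fun [set: 'rV[R]_n] f /\ has_ubound (range f).

Definition same_type f h : Prop :=
  exists (a c : R) (b : 'rV[R]_n) (d : R),
    [/\ 0 < a, 0 < c & forall x, h x = c * f (a *: x + b) + d].

Definition cos_sum (x : 'rV[R]_n) : R := cos (\sum_(j < n) x ord0 j).

Definition all_payoffs : set ('rV[R]_n -> R) := [set f | payoff f].

Definition continuous_payoffs : set ('rV[R]_n -> R) :=
  [set f | payoff f /\ continuous f].

Definition bounded_payoffs : set ('rV[R]_n -> R) :=
  [set f | payoff f /\ bounded_fun f].

Definition bounded_continuous_payoffs : set ('rV[R]_n -> R) :=
  [set f | [/\ payoff f, bounded_fun f & continuous f]].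

Definition cos_type_payoffs : set ('rV[R]_n -> R) :=
  [set f | payoff f /\ same_type cos_sum f].

End payoffs.

Section darts.
Context d (T : measurableType d) (R : realType) (P : probability T R) (n : nat).
Implicit Types (X Y : T -> 'rV[R]_n) (f : 'rV[R]_n -> R).

Definition dart X : Prop := measurable_fun [set: T] X.

(* The integral behind 'E_P is the difference of the integrals of the positive
   and negative parts; for f bounded above it is the usual expectation with
   values in [-oo, +oo[. *)
Definition sup_expected f Y : \bar R :=
  ereal_sup (range (fun a : 'rV[R]_n => 'E_P[fun w => f (a + Y w)%R]%E)).

Definition optimal_payoff X f (s : R) : \bar R :=
  sup_expected f (fun w => s *: X w).

Definition reasonable X f : Prop :=
  forall s t : R, 0 < s -> s <= t ->
    (optimal_payoff X f t <= optimal_payoff X f s)%E.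

Definition reasonable_darts (F : set ('rV[R]_n -> R)) : set (T -> 'rV[R]_n) :=
  [set X | dart X /\ forall f, F f -> reasonable X f].

Definition independent_darts (m : nat) (X : 'I_m -> T -> 'rV[R]_n) : Prop :=
  forall (J : {set 'I_m}) (B : 'I_m -> set 'rV[R]_n),
    (forall j, measurable (B j)) ->
    P (\bigcap_(j in [set` J]) (X j @^-1` B j)) =
      (\prod_(j in J) P (X j @^-1` B j))%E.

End darts.

(* Main.v *)
Require Import Defs.
From HB Require Import structures.
From mathcomp Require Import all_boot all_order all_algebra.
From mathcomp Require Import all_classical all_reals all_analysis.
From mathcomp Require Import measurable_realfun.
From mathcomp Require Import ring lra.

(** Fix all darts but one, [U := X j], and let [Y] be the scaled sum of the
    others.  By independence and Fubini, the expectation of [f (a + t U + Y)]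
    is that of [g (a + t U)], where [g x] is the expectation of [f (x + Y)].
    If [g] lies again in the family, reasonableness of [U] for [g] lets the
    scale [t] of this one dart decrease; changing the scales one dart at a time
    gives the theorem ([sup_expected_scale_sum]).

    For payoffs of cosine type, [g] is of cosine type or constant: the
    expectations of the cosine and the sine of the phase of [Y], written in
    polar coordinates, only change amplitude and phase ([avg_cos_type]).

    Among the other four families, averaging can leave those that have unbounded
    payoffs, since [g] may then take the value -oo.  But all four families
    contain the bounded Lipschitz functions, and these are stable under
    averaging ([avg_bounded_lipschitz]), which gives the inequality for them.
    It is then transferred to every payoff ([sup_expected_transfer]):
    if [sup_a E h(a + U) <= sup_a E h(a + V)] for all bounded Lipschitz [h],
    the same holds for all payoffs.  Here is why.  Replace a payoff by the cost
    [phi := M - f >= 0] and assume that [E phi(U)] is finite.  Cutting [phi]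
    into layers of height [s], the sets [phi > i s] have open neighbourhoods
    [O_i] that contain the complement of a bounded set and have almost the same
    probability for [U] (inner regularity of the law of [U]).  The functions
    [v_k = s * \sum_(i < k) min(1, k * dist(., ~ O_i))] are bounded Lipschitz,
    increase with [k], are eventually at least [phi] at each point, and satisfy
    [E v_k(U) <= E phi(U) + 2 s].  By hypothesis, each set
    [K_k = {a | E v_k(a + V) <= E phi(U) + 3 s}] is nonempty; these sets are
    closed, decrease with [k], and are bounded for large [k] because [v_k] is
    large far away.  By compactness some [a] belongs to all of them, and
    monotone convergence gives [E phi(a + V) <= E phi(U) + 3 s]. *)

Set Implicit Arguments.
Unset Strict Implicit.
Unset Printing Implicit Defensive.

Import Order.TTheory GRing.Theory Num.Theory.
Import numFieldNormedType.Exports.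

Local Open Scope classical_set_scope.
Local Open Scope ring_scope.

(** * The Borel sigma-algebra of row vectors *)

Section borel_row_vectors.
Context (R : realType) (n : nat).

Lemma measurable_open (A : set 'rV[R]_n) : open A -> measurable A.
Proof. exact: sub_gen_smallest. Qed.

Lemma measurable_closed (A : set 'rV[R]_n) : closed A -> measurable A.
Proof.
move=> cA; rewrite -[A]setCK; apply: measurableC.
by apply: measurable_open; exact: closed_openC.
Qed.

Lemma measurable_fun_continuous (f : 'rV[R]_n -> R) :
  continuous f -> measurable_fun [set: 'rV[R]_n] f.
Proof.
move=> /continuousP cf.
apply: (measurability (@RGenOpens.G R)).
  exact: RGenOpens.measurableE.
move=> _ [_ [a [b ->]] <-]; rewrite setTI.
apply: measurable_open; apply: cf.
exact: (@interval_open R (BRight a) (BLeft b)).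
Qed.

Lemma measurable_coord (j : 'I_n) :
  measurable_fun [set: 'rV[R]_n] (fun v : 'rV[R]_n => v ord0 j).
Proof. apply: measurable_fun_continuous; exact: coord_continuous. Qed.

Definition rat_ball (p : 'rV[rat]_n * nat) : set 'rV[R]_n :=
  ball (map_mx (@ratr R) p.1 : 'rV[R]_n) p.2.+1%:R^-1.

(** Second countability: the balls with rational centre and radius 1/(k+1) form
    a countable basis. *)
Lemma rat_ball_basis (A : set 'rV[R]_n) x : open A -> A x ->
  exists2 p, rat_ball p x & rat_ball p `<=` A.
Proof.
move=> oA Ax.
have /nbhs_ballP[e /= e0 xeA] : nbhs x A by rewrite nbhsE; exists A.
have [k ke] : exists k : nat, k.+1%:R^-1 < e / 2 :> R.
  exists (Num.truncn (e / 2)^-1).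
  rewrite invf_plt ?posrE// ?divr_gt0//.
  exact: truncnS_gt.
have /choice[r xr] (j : 'I_n) : exists q : rat, `|x ord0 j - ratr q| < k.+1%:R^-1.
  have [|q] := @rat_in_itvoo R (x ord0 j - k.+1%:R^-1) (x ord0 j).
    by rewrite ltrBlDr ltrDl.
  rewrite in_itv/= => /andP[h1 h2]; exists q.
  by rewrite ger0_norm ?subr_ge0 1?ltW// ltrBlDl -ltrBlDr.
pose q := \row_j r j.
have xq : ball (map_mx (@ratr R) q : 'rV[R]_n) k.+1%:R^-1 x.
  split; first by rewrite invr_gt0.
  move=> i j; rewrite !mxE ord1; apply: ball_sym.
  exact: xr.
exists (q, k) => // y /= hy; apply: xeA.
rewrite [e]splitr; apply: (@ball_triangle _ _ (map_mx (@ratr R) q : 'rV[R]_n)).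
  by apply/ball_sym/(le_ball (ltW ke)).
exact: (le_ball (ltW ke)).
Qed.

End borel_row_vectors.

Section measurable_row_valued.
Context d (T : measurableType d) (R : realType) (n : nat).
Implicit Types f g : T -> 'rV[R]_n.

(** An open set is a countable union of rational balls, and a ball for the
    maximum norm is a box, so the coordinates generate the Borel sets. *)
Lemma measurable_fun_coords f :
  (forall j, measurable_fun [set: T] (fun x => f x ord0 j)) ->
  measurable_fun [set: T] f.
Proof.
move=> mf; apply: (measurability (@open 'rV[R]_n)) => //.
move=> _ [A oA <-]; rewrite setTI.
have -> : f @^-1` A = \bigcup_i (if unpickle i is Some p then
    if `[< rat_ball p `<=` A >] then f @^-1` (rat_ball p) else set0 else set0).
  apply/seteqP; split=> [x /= Afx|x [i _]].
    have [p px pA] := rat_ball_basis oA Afx.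
    by exists (pickle p) => //; rewrite pickleK asboolT.
  by case: unpickle => // p; case: asboolP => // pA; exact: pA.
apply: bigcupT_measurable => i; case: unpickle => // -[q k].
case: asboolP => // _.
have -> : f @^-1` (rat_ball (q, k)) =
    \bigcap_(j in [set: 'I_n])
      ((fun x => f x ord0 j) @^-1` ball (ratr (q ord0 j) : R) k.+1%:R^-1).
  apply/seteqP; split => [x /= [_ h] j _|x h]; first by have := h ord0 j; rewrite mxE.
  split; first by rewrite invr_gt0.
  by move=> i0 j; rewrite ord1 mxE; exact: h.
apply: fin_bigcap_measurable; first exact: finite_finset.
by move=> j _; rewrite -[X in measurable X]setTI; apply: mf => //; exact: measurable_ball.
Qed.

Lemma measurable_fun_coord f j : measurable_fun [set: T] f ->
  measurable_fun [set: T] (fun x => f x ord0 j).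
Proof. by move=> mf; exact: (measurableT_comp (measurable_coord j) mf). Qed.

Lemma measurable_fun_addv f g : measurable_fun [set: T] f ->
  measurable_fun [set: T] g -> measurable_fun [set: T] (fun x => f x + g x).
Proof.
move=> mf mg; apply: measurable_fun_coords => j.
under eq_fun do rewrite mxE.
by apply: measurable_funD; exact: measurable_fun_coord.
Qed.

Lemma measurable_fun_scalev (c : R) f : measurable_fun [set: T] f ->
  measurable_fun [set: T] (fun x => c *: f x).
Proof.
move=> mf; apply: measurable_fun_coords => j.
under eq_fun do rewrite mxE.
by apply: measurable_funM => //; exact: measurable_fun_coord.
Qed.

Lemma measurable_fun_sumv (I : Type) (r : seq I) (A : pred I)
    (F : I -> T -> 'rV[R]_n) : (forall i, A i -> measurable_fun [set: T] (F i)) ->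
  measurable_fun [set: T] (fun x => \sum_(i <- r | A i) F i x).
Proof.
move=> mF; elim: r => [|i r IHr].
  by under eq_fun do rewrite big_nil; exact: measurable_cst.
under eq_fun do rewrite big_cons.
case: (boolP (A i)) => // Ai; by apply: measurable_fun_addv => //; exact: mF.
Qed.

End measurable_row_valued.

(** * Inner regularity of finite Borel measures *)

Section capped_distance.
Context (R : realType) (n : nat).
Implicit Types (C : set 'rV[R]_n) (x y : 'rV[R]_n).

(** The distance to [C] capped at 1.  The cap is an element of the set whose
    infimum is taken, so that the empty set [C] gets distance 1. *)
Definition capdist C x : R := inf (1 |` [set `|x - y| | y in C]).

Let capdist_has_inf C x : has_inf (1 |` [set `|x - y| | y in C]).
Proof.
split; first by exists 1; left.
by exists 0 => _ [->|[y _ <-]].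
Qed.

Lemma capdist_ge0 C x : 0 <= capdist C x.
Proof.
apply: lb_le_inf; first by case: (capdist_has_inf C x).
by move=> _ [->|[y _ <-]].
Qed.

Lemma capdist_le1 C x : capdist C x <= 1.
Proof. by apply: ge_inf; [case: (capdist_has_inf C x)|left]. Qed.

Lemma capdist_le C x y : C y -> capdist C x <= `|x - y|.
Proof. by move=> Cy; apply: ge_inf; [case: (capdist_has_inf C x)|right; exists y]. Qed.

Lemma le_capdist C x (e : R) :
  e <= 1 -> (forall y, C y -> e <= `|x - y|) -> e <= capdist C x.
Proof.
move=> e1 h; apply: lb_le_inf; first by case: (capdist_has_inf C x).
by move=> _ [->|[y Cy <-]] //; exact: h.
Qed.

Lemma capdist_eq0 C x : C x -> capdist C x = 0.
Proof.
move=> Cx; apply/le_anti; rewrite capdist_ge0 andbT.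
by rewrite (le_trans (capdist_le x Cx))// subrr normr0.
Qed.

Lemma capdist_gt0 C x : closed C -> ~ C x -> 0 < capdist C x.
Proof.
move=> cC nCx; have /nbhs_ballP[e /= e0 xe] : nbhs x (~` C).
  by rewrite nbhsE; exists (~` C) => //; split => //; exact: closed_openC.
apply: (@lt_le_trans _ _ (Num.min 1 e)); first by rewrite lt_min ltr01.
apply: le_capdist => [|y Cy]; first by rewrite ge_min lexx.
rewrite ge_min; apply/orP; right; rewrite leNgt.
by apply/negP => xy; apply: (xe y) => //; rewrite mx_norm_ball.
Qed.

Lemma capdist_lipschitz C x y : `|capdist C x - capdist C y| <= `|x - y|.
Proof.
have h u v : capdist C u - capdist C v <= `|u - v|.
  rewrite lerBlDr -lerBlDl; apply: le_capdist => [|z Cz].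
    by rewrite (le_trans _ (capdist_le1 C u))// lerBlDl lerDr.
  rewrite lerBlDl (le_trans (capdist_le u Cz))//.
  by rewrite -[u - z](subrKA v) ler_normD.
by rewrite ler_norml h andbT lerNl opprB distrC h.
Qed.

End capped_distance.

Section bounded_lipschitz.
Context (R : realType) (n : nat).

Definition bounded_lipschitz (h : 'rV[R]_n -> R) : Prop :=
  exists L M : R, [/\ 0 <= L, forall x, `|h x| <= M &
    forall x y, `|h x - h y| <= L * `|x - y|].

Lemma continuous_of_lipschitz (L : R) (h : 'rV[R]_n -> R) :
  0 <= L -> (forall x y, `|h x - h y| <= L * `|x - y|) -> continuous h.
Proof.
move=> L0 hL x; have FF : Filter (nbhs x) by exact: nbhs_filter.
apply/(@cvgrPdist_lt _ _ _ (nbhs x) FF) => /= e e0.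
have L1 : 0 < L + 1 by rewrite ltr_wpDl.
apply/nbhs_ballP; exists (e / (L + 1)); first exact: divr_gt0.
move=> y; rewrite mx_norm_ball /ball_/= ltr_pdivlMr// mulrC => xy.
rewrite (le_lt_trans (hL _ _))// (le_lt_trans _ xy)//.
by rewrite ler_wpM2r// lerDl.
Qed.

Lemma bounded_lipschitz_continuous h : bounded_lipschitz h -> continuous h.
Proof. by move=> [L [M [L0 _ hL]]]; exact: (continuous_of_lipschitz L0). Qed.

Lemma capdist_continuous (C : set 'rV[R]_n) : continuous (capdist C).
Proof.
apply: (@continuous_of_lipschitz 1) => // x y.
by rewrite mul1r; exact: capdist_lipschitz.
Qed.

End bounded_lipschitz.

Section regularity.
Context (R : realType) (n : nat) (mu : {finite_measure set 'rV[R]_n -> \bar R}).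
Local Open Scope ereal_scope.

Let fin (A : set 'rV[R]_n) : measurable A -> mu A < +oo.
Proof.
move=> mA; apply: (@le_lt_trans _ _ (mu setT)).
  by apply: le_measure; rewrite ?inE.
by have := @fin_num_measure _ _ _ mu _ measurableT; rewrite ge0_fin_numE.
Qed.

Lemma exists_measure_lt (F : (set 'rV[R]_n)^nat) (e : \bar R) :
  (forall i, measurable (F i)) -> nonincreasing_seq F ->
  mu (\bigcap_i F i) < e -> exists i, mu (F i) < e.
Proof.
move=> mF ndF Fe.
have h := @nonincreasing_cvg_mu _ _ _ mu F (fin (mF 0%N)) mF
  (bigcapT_measurable mF) ndF.
apply: contrapT => /forallNP nF; move: Fe; apply/negP; rewrite -leNgt.
rewrite -(cvg_lim _ h)//; apply: lime_ge; first by apply/cvg_ex; eexists; exact: h.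
by apply: nearW => i /=; rewrite leNgt; apply/negP; exact: nF.
Qed.

(** The usual intermediate notion: unlike inner approximability by closed sets,
    it is stable under complement. *)
Definition regular (A : set 'rV[R]_n) : Prop := forall e : R, (0 < e)%R ->
  exists C O, [/\ closed C, open O, C `<=` A, A `<=` O & mu (O `\` C) < e%:E].

(** The closed sets of points at distance at least 1/(i+1) from the complement
    exhaust an open set. *)
Lemma regular_open (A : set 'rV[R]_n) : open A -> regular A.
Proof.
move=> oA e e0.
pose C i := [set x | (i.+1%:R^-1 <= capdist (~` A) x)%R].
have cC i : closed (C i).
  apply: (@closed_comp _ _ (capdist (~` A)) [set r | (i.+1%:R^-1 <= r)%R]).
    by move=> x _; exact: capdist_continuous.
  exact: closed_ge.
have CA i : C i `<=` A.
  move=> x Cx; apply: contrapT => nAx; move: Cx.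
  by rewrite /C /= capdist_eq0// leNgt invr_gt0 ltr0n.
have [i ie] : exists i, mu (A `\` C i) < e%:E.
  apply: exists_measure_lt.
  - move=> i; apply: measurableD; first exact: measurable_open.
    exact: measurable_closed.
  - apply/nonincreasing_seqP => i; apply/subsetPset => x [Ax nC]; split => //=.
    apply: contra_not nC => /=; apply: le_trans.
    by rewrite lef_pV2 ?posrE// ler_nat.
  rewrite [X in mu X](_ : _ = set0) ?measure0//.
  apply/seteqP; split => // x h.
  have [Ax _] := h 0%N I.
  have d0 : (0 < capdist (~` A) x)%R.
    by apply: capdist_gt0; [exact: open_closedC|move=> /(_ Ax)].
  have [_] := h (Num.truncn (capdist (~` A) x)^-1) I; apply => /=.
  by rewrite /C/= invf_ple ?posrE//; exact/ltW/truncnS_gt.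
by exists (C i), A; split.
Qed.

(** The errors of the unions are controlled by a geometric series; the union of
    the closed sets is cut to a finite one by continuity from above. *)
Lemma regular_bigcup (A : (set 'rV[R]_n)^nat) :
  (forall i, regular (A i)) -> regular (\bigcup_i A i).
Proof.
move=> rA e e0.
have /choice[CO hCO] : forall i : nat, exists CO : set 'rV[R]_n * set 'rV[R]_n, 
    [/\ closed CO.1, open CO.2, CO.1 `<=` A i, A i `<=` CO.2 &
      mu (CO.2 `\` CO.1) < (e / 2 / (2 ^ i.+1)%:R)%:E].
  move=> i; have [|C [ O h]] := rA i (e / 2 / (2 ^ i.+1)%:R)%R; last by exists (C, O).
  by rewrite !divr_gt0// ltr0n expn_gt0.
pose C i := (CO i).1; pose O i := (CO i).2.
pose K i := \bigcup_(j in [set j | (j < i)%N]) C j.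
have cC i : closed (C i) by case: (hCO i).
have oO i : open (O i) by case: (hCO i).
have mC i : measurable (C i) by exact: measurable_closed.
have mO i : measurable (O i) by exact: measurable_open.
have cK i : closed (K i).
  apply: closed_bigcup => //; exact: finite_II.
have [i ie] : exists i, mu (\bigcup_i O i `\` K i) < e%:E.
  apply: exists_measure_lt.
  - move=> i; apply: measurableD; first exact: bigcupT_measurable.
    exact: measurable_closed.
  - apply/nonincreasing_seqP => i; apply/subsetPset => x [Ox nK]; split => //.
    by apply: contra_not nK => -[j /= ji Cj]; exists j => //=; rewrite ltnW.
  apply: (@le_lt_trans _ _ (mu (\bigcup_i (O i `\` C i)))).
    apply: le_measure; rewrite ?inE.
    - apply: bigcapT_measurable => i; apply: measurableD.
        exact: bigcupT_measurable.
      exact: measurable_closed.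
    - by apply: bigcupT_measurable => i; exact: measurableD.
    - move=> x h; have [[j _ Oj] _] := h 0%N I.
      exists j => //; split => // Cj; have [_] := h j.+1 I; apply.
      by exists j => /=.
  apply: (@le_lt_trans _ _ (e / 2)%:E); last first.
    by rewrite lte_fin ltr_pdivrMr// ltr_pMr// ltr1n.
  apply: le_trans (generalized_Boole_inequality _ _ _) _.
  - by move=> i; exact: measurableD.
  - by apply: bigcupT_measurable => i; exact: measurableD.
  have e2 : (0 <= e / 2)%R by rewrite divr_ge0// ltW.
  apply: le_trans (epsilon_trick0 xpredT e2).
  by apply: lee_nneseries => // i _; apply/ltW; case: (hCO i).
exists (K i), (\bigcup_i O i); split => //.
- exact: bigcup_open.
- by move=> x [j _ Cj]; exists j => //; case: (hCO j) => _ _ + _ _; exact.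
- by move=> x [j _ Aj]; exists j => //; case: (hCO j) => _ _ _ + _; exact.
Qed.

Lemma measurable_regular (A : set 'rV[R]_n) : measurable A -> regular A.
Proof.
apply: smallest_sub; last by move=> B; exact: regular_open.
split => /=.
- move=> e e0; exists set0, set0; split => //; first exact: closed0.
  by rewrite setD0 measure0.
- move=> B rB e e0; have [C [ O [cC oO CB BO h]]] := rB e e0.
  exists (~` O), (~` C); split.
  + exact: open_closedC.
  + exact: closed_openC.
  + by rewrite setTD; exact: subsetC.
  + by rewrite setTD; exact: subsetC.
  + by rewrite setDE setCK setIC -setDE.
- by move=> F rF; exact: regular_bigcup.
Qed.

(** Balls exhaust the space, so the closed set can moreover be taken bounded. *)
Lemma inner_regular (A : set 'rV[R]_n) (e : R) : measurable A -> (0 < e)%R ->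
  exists2 C, closed C & [/\ C `<=` A,
    exists r : R, forall x, C x -> (`|x| <= r)%R & mu (A `\` C) < e%:E].
Proof.
move=> mA e0; have e2 : (0 < e / 2)%R by rewrite divr_gt0.
have [C [ O [cC oO CA AO COe]]] := measurable_regular mA e2.
pose B i := [set x : 'rV[R]_n | (`|x| <= i%:R)%R].
have cB i : closed (B i).
  apply: (@closed_comp _ _ (fun x : 'rV[R]_n => `|x|%R) [set r | (r <= i%:R)%R]).
    by move=> x _; exact: norm_continuous.
  exact: closed_le.
have [i ie] : exists i, mu (~` B i) < (e / 2)%:E.
  apply: exists_measure_lt.
  - by move=> i; apply: measurableC; exact: measurable_closed.
  - apply/nonincreasing_seqP => i; apply/subsetPset; apply: subsetC => x h.
    by apply: le_trans h _; rewrite ler_nat.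
  rewrite [X in mu X](_ : _ = set0) ?measure0 ?lte_fin//.
  apply/seteqP; split => // x /(_ (Num.truncn `|x|).+1 I); apply.
  exact/ltW/truncnS_gt.
exists (C `&` B i); first exact: closedI.
split; first by move=> x [/CA].
  by exists i%:R => x [].
have mC : measurable C by exact: measurable_closed.
have mO : measurable O by exact: measurable_open.
have mB : measurable (B i) by exact: measurable_closed.
apply: (@le_lt_trans _ _ (mu ((O `\` C) `|` ~` B i))).
  apply: le_measure; rewrite ?inE.
  - by apply: measurableD => //; exact: measurableI.
  - by apply: measurableU; [exact: measurableD|exact: measurableC].
  - move=> x [Ax nCB]; have [Bx|] := pselect (B i x); last by right.
    by left; split; [exact: AO|move=> Cx; exact: nCB].
apply: le_lt_trans (measureU2 _ _ _) _.
- exact: measurableD.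
- exact: measurableC.
- by rewrite [e]splitr EFinD lteD.
Qed.

End regularity.

(** * Averages of bounded functions *)

Section bounded_expectation.
Context d (T : measurableType d) (R : realType) (P : probability T R).

Lemma bounded_integrable (Z : T -> R) (M : R) : measurable_fun [set: T] Z ->
  (forall w, `|Z w| <= M) -> P.-integrable [set: T] (EFin \o Z).
Proof.
move=> mZ ZM; apply: measurable_bounded_integrable => //.
  by apply: le_lt_trans (probability_le1 P measurableT) _; rewrite ltry.
exists M; split; first exact: num_real.
by move=> x Mx w _ /=; rewrite (le_trans (ZM w))// ltW.
Qed.

Lemma bounded_Rintegral (Z : T -> R) (M : R) : measurable_fun [set: T] Z ->
  (forall w, `|Z w| <= M) -> `|\int[P]_w Z w| <= M.
Proof.
move=> mZ ZM; have iZ := bounded_integrable mZ ZM.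
rewrite (le_trans (le_normr_Rintegral _ _))//.
have <- : \int[P]_w M = M by rewrite Rintegral_cst//= probability_setT mulr1.
apply: le_Rintegral => //; first exact: integrable_norm iZ.
exact: finite_measure_integrable_cst.
Qed.

Lemma expectation_Rintegral (Z : T -> R) : P.-integrable [set: T] (EFin \o Z) ->
  'E_P[Z]%E = (\int[P]_w Z w)%:E.
Proof. by move=> iZ; rewrite unlock /Rintegral fineK//; exact: integrable_fin_num. Qed.

End bounded_expectation.

Section averages.
Context d (T : measurableType d) (R : realType) (P : probability T R) (n : nat).
Implicit Types (V : T -> 'rV[R]_n) (h : 'rV[R]_n -> R).

Definition avg h V (a : 'rV[R]_n) : R := \int[P]_w h (a + V w).

Lemma measurable_fun_shift h V (a : 'rV[R]_n) :
  measurable_fun [set: 'rV[R]_n] h -> measurable_fun [set: T] V ->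
  measurable_fun [set: T] (fun w => h (a + V w)).
Proof.
move=> mh mV; apply: (measurableT_comp mh).
by apply: measurable_fun_addv => //; exact: measurable_cst.
Qed.

Lemma bounded_lipschitz_measurable h :
  bounded_lipschitz h -> measurable_fun [set: 'rV[R]_n] h.
Proof.
by move=> hL; apply: measurable_fun_continuous; exact: bounded_lipschitz_continuous.
Qed.

Lemma bounded_lipschitz_integrable h V (a : 'rV[R]_n) :
  bounded_lipschitz h -> measurable_fun [set: T] V ->
  P.-integrable [set: T] (EFin \o (fun w => h (a + V w))).
Proof.
move=> hL mV; have [_ [M [_ hM _]]] := hL.
apply: (@bounded_integrable _ _ _ _ _ M) => //.
by apply: measurable_fun_shift => //; exact: bounded_lipschitz_measurable.
Qed.

(** An average of translates keeps both the bound and the Lipschitz constant. *)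
Lemma avg_bounded_lipschitz h V : bounded_lipschitz h ->
  measurable_fun [set: T] V -> bounded_lipschitz (avg h V).
Proof.
move=> hL mV; have [L [M [L0 hM hLip]]] := hL.
have mh a : measurable_fun [set: T] (fun w => h (a + V w)).
  by apply: measurable_fun_shift => //; exact: bounded_lipschitz_measurable.
exists L, M; split => // [a|a b]; first exact: bounded_Rintegral.
rewrite /avg -RintegralB//; try exact: bounded_lipschitz_integrable.
apply: bounded_Rintegral => [|w]; first exact: measurable_funB.
by rewrite (le_trans (hLip _ _))// opprD addrACA subrr addr0.
Qed.

End averages.

(** * Staircases of capped distances *)

Section layer_cake.
Context (R : realType) (n : nat) (e : R) (C : nat -> set 'rV[R]_n).
Hypothesis e0 : 0 < e.
Hypothesis cC : forall i, closed (C i).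

(** Increases with [k] to the indicator of the complement of [C i]. *)
Definition plateau (k i : nat) (x : 'rV[R]_n) : R :=
  Num.min 1 (k%:R * capdist (C i) x).

(** The sums [v_k] of the introduction, with [C i] the complement of [O_i]; the
    slope and the number of steps grow together. *)
Definition staircase (k : nat) (x : 'rV[R]_n) : R :=
  \sum_(i < k) e * plateau k i x.

Lemma plateau_ge0 k i x : 0 <= plateau k i x.
Proof. by rewrite le_min ler01 mulr_ge0// capdist_ge0. Qed.

Lemma plateau_le1 k i x : plateau k i x <= 1.
Proof. by rewrite ge_min lexx. Qed.

Lemma plateau_eq0 k i x : C i x -> plateau k i x = 0.
Proof. by move=> Cx; rewrite /plateau capdist_eq0// mulr0 min_r. Qed.

Lemma plateau_lipschitz k i x y :
  `|plateau k i x - plateau k i y| <= k%:R * `|x - y|.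
Proof.
have h u v : plateau k i u - plateau k i v <= k%:R * `|u - v|.
  rewrite lerBlDr /plateau.
  have duv : k%:R * capdist (C i) u <=
      k%:R * `|u - v| + k%:R * capdist (C i) v.
    rewrite -mulrDr ler_wpM2l// -lerBlDr.
    by rewrite (le_trans (ler_norm _))// capdist_lipschitz.
  case: (leP 1 (k%:R * capdist (C i) v)) => [v1|v1].
    by rewrite ge_min lerDr mulr_ge0.
  by rewrite ge_min duv orbT.
by rewrite ler_norml h andbT lerNl opprB distrC h.
Qed.

Lemma staircase_ge0 k x : 0 <= staircase k x.
Proof. by apply: sumr_ge0 => i _; rewrite mulr_ge0 ?plateau_ge0// ltW. Qed.

Lemma staircase_bounded_lipschitz k : bounded_lipschitz (staircase k).
Proof.
exists (\sum_(i < k) e * k%:R), (\sum_(i < k) e); split.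
- by apply: sumr_ge0 => i _; rewrite mulr_ge0// ltW.
- move=> x; rewrite ger0_norm ?staircase_ge0//; apply: ler_sum => i _.
  by rewrite ler_piMr ?plateau_le1// ltW.
- move=> x y; rewrite /staircase -sumrB mulr_suml (le_trans (ler_norm_sum _ _ _))//.
  apply: ler_sum => i _; rewrite -mulrBr normrM gtr0_norm// -mulrA.
  by rewrite ler_wpM2l ?plateau_lipschitz// ltW.
Qed.

Lemma plateau_mono k l i x : (k <= l)%N -> plateau k i x <= plateau l i x.
Proof.
move=> kl; rewrite /plateau; apply: le_min2 => //.
by rewrite ler_wpM2r ?capdist_ge0// ler_nat.
Qed.

Lemma staircase_mono k l x : (k <= l)%N -> staircase k x <= staircase l x.
Proof.
move=> kl; rewrite /staircase.
rewrite -(big_mkord xpredT (fun i => e * plateau k i x)).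
rewrite -(big_mkord xpredT (fun i => e * plateau l i x)).
rewrite [leRHS](big_cat_nat (leq0n k) kl)//= ler_wpDr//.
  by apply: sumr_ge0 => i _; rewrite mulr_ge0 ?plateau_ge0// ltW.
apply: ler_sum => i _; rewrite ler_wpM2l ?plateau_mono//; exact: ltW.
Qed.

(** The first [N] plateaus reach height 1 at [x] after finitely many steps, so
    the bound is attained and not only approached. *)
Lemma staircase_eventually_ge (N : nat) x : (forall i, (i < N)%N -> ~ C i x) ->
  exists k, e *+ N <= staircase k x.
Proof.
move=> nC.
have [k0 hk0] : exists k0, forall i, (i < N)%N -> plateau k0 i x = 1.
  elim: N nC => [|N IHN] nC; first by exists 0%N.
  have [k hk] := IHN (fun i iN => nC i (ltnW iN)).
  have dN : 0 < capdist (C N) x by apply: capdist_gt0 => //; exact: nC.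
  pose l := maxn k (Num.truncn (capdist (C N) x)^-1).+1.
  exists l => i; rewrite ltnS leq_eqVlt => /predU1P[->|iN].
    apply/min_l; rewrite -ler_pdivrMr// div1r.
    by rewrite (le_trans (ltW (truncnS_gt _)))// ler_nat leq_maxr.
  apply/le_anti; rewrite plateau_le1/= -(hk i iN).
  by apply: plateau_mono; exact: leq_maxl.
exists (maxn k0 N).
apply: (@le_trans _ _ (\sum_(0 <= i < N) e * plateau (maxn k0 N) i x)).
  rewrite -[X in e *+ X]subn0 -sumr_const_nat.
  rewrite big_nat [leRHS]big_nat; apply: ler_sum => i /= iN.
  apply: ler_peMr; first exact: ltW.
  rewrite -(hk0 i iN); apply: plateau_mono; exact: leq_maxl.
rewrite /staircase -(big_mkord xpredT (fun i => e * plateau _ i x)).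
rewrite (big_cat_nat (leq0n N) (leq_maxr k0 N))//= lerDl.
by apply: sumr_ge0 => i _; rewrite mulr_ge0 ?plateau_ge0// ltW.
Qed.

Lemma staircase_eq k x : (0 < k)%N ->
  (forall i y, (i < k)%N -> C i y -> 1 <= `|x - y|) -> staircase k x = e *+ k.
Proof.
move=> k0 far; rewrite /staircase (eq_bigr (fun=> e)) => [|i _].
  by rewrite sumr_const card_ord.
have -> : plateau k i x = 1; last by rewrite mulr1.
apply/min_l; rewrite -[leLHS]mulr1 ler_pM ?ler1n//.
by apply: le_capdist => // y; exact: far.
Qed.

(** The layer-cake decomposition of [u] into layers of height [e] overshoots by
    at most one layer. *)
Lemma sum_indicator_levels_le (u : R) k : 0 <= u ->
  \sum_(i < k) e * (e * i%:R < u)%R%:R <= u + e.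
Proof.
move=> u0; suff : \sum_(i < k) e * (e * i%:R < u)%R%:R <= e * k%:R /\
    \sum_(i < k) e * (e * i%:R < u)%R%:R <= u + e by case.
elim: k => [|k [IH1 IH2]]; first by rewrite !big_ord0 mulr0 addr_ge0// ltW.
rewrite !big_ord_recr/=; case: ltP => h; rewrite ?mulr1 ?mulr0 ?addr0.
  split; first by rewrite -natr1 mulrDr mulr1 lerD2r.
  by rewrite lerD2r (le_trans IH1)// ltW.
by split => //; rewrite (le_trans IH1)// ler_wpM2l ?ler_nat// ltW.
Qed.

End layer_cake.

(** * Transfer from bounded Lipschitz functions to all payoffs *)

Lemma sum_half_powers (R : realType) k :
  \sum_(i < k) (2 ^ i.+1)%:R^-1 = 1 - (2 ^ k)%:R^-1 :> R.
Proof.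
elim: k => [|k IHk]; first by rewrite big_ord0 expn0 invr1 subrr.
rewrite big_ord_recr/= IHk expnS natrM invfM.
have := @splitr R (2 ^ k)%:R^-1; rewrite mulrC => {1}->.
by rewrite opprD addrA subrK.
Qed.

Section transfer.
Context d (T : measurableType d) (R : realType) (P : probability T R) (n : nat).
Context (U V : T -> 'rV[R]_n).
Hypothesis mU : measurable_fun [set: T] U.
Hypothesis mV : measurable_fun [set: T] V.
Hypothesis domUV : forall h, bounded_lipschitz h ->
  (sup_expected P h U <= sup_expected P h V)%E.

(** The hypothesis on suprema, read for costs instead of gains. *)
Lemma avg_almost_le (h : 'rV[R]_n -> R) (e : R) : bounded_lipschitz h -> 0 < e ->
  exists a, avg P h V a <= \int[P]_w h (U w) + e.
Proof.
move=> hL e0; apply: contrapT => /forallNP nle.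
have Nh : bounded_lipschitz (fun x => - h x).
  have [L [M [L0 hM hLip]]] := hL; exists L, M; split => // [x|x y].
    by rewrite normrN.
  by rewrite -opprD normrN.
have EN (W : T -> 'rV[R]_n) a : measurable_fun [set: T] W ->
    'E_P[fun w => (- h (a + W w))%R]%E = (- avg P h W a)%:E.
  move=> mW; rewrite expectation_Rintegral; last exact: bounded_lipschitz_integrable Nh mW.
  congr EFin; rewrite /avg -mulN1r -RintegralZl//; last first.
    exact: bounded_lipschitz_integrable.
  by apply: eq_Rintegral => w _; rewrite mulN1r.
have : (sup_expected P (fun x => - h x)%R V <= (- (\int[P]_w h (U w) + e))%:E)%E.
  apply: ge_ereal_sup => _ [a _ <-]; rewrite EN// lee_fin lerN2 ltW// ltNge.
  by apply/negP; exact: nle.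
apply/negP; rewrite -ltNge; apply: lt_le_trans (domUV Nh).
apply: (@lt_le_trans _ _ (- avg P h U 0)%:E).
  rewrite lte_fin ltrN2 /avg.
  under eq_Rintegral do rewrite add0r.
  by rewrite ltrDl.
by rewrite -EN//; apply: ereal_sup_ubound; exists 0.
Qed.

Let law (W : T -> 'rV[R]_n) (mW : measurable_fun [set: T] W) :
  probability 'rV[R]_n R := distribution P (mfun_Sub (mem_set mW)).

(** The compactness argument of the introduction. *)
Lemma transfer_cost (phi : 'rV[R]_n -> R) (e : R) :
  measurable_fun [set: 'rV[R]_n] phi -> (forall x, 0 <= phi x) ->
  (\int[P]_w (phi (U w))%:E < +oo)%E -> 0 < e ->
  exists a, (\int[P]_w (phi (a + V w))%:E <=
             \int[P]_w (phi (U w))%:E + e%:E)%E.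
Proof.
move=> mphi phi0 Ifin e_gt0.
pose I := fine (\int[P]_w (phi (U w))%:E)%E.
have IE : (\int[P]_w (phi (U w))%:E = I%:E)%E.
  by rewrite fineK// ge0_fin_numE// integral_ge0// => w _; rewrite lee_fin.
(* one third for the layers, one for the open neighbourhoods, and one for a
   nearly optimal translation *)
have [s s0 ess] : exists2 s : R, 0 < s & s + s + s = e.
  by exists (e / 3); [rewrite divr_gt0|field].
pose B i := [set x | s * i%:R < phi x].
have mB i : measurable (B i).
  rewrite /B -[X in measurable X]setTI.
  rewrite [X in _ `&` X](_ : _ = phi @^-1` `]s * i%:R, +oo[%classic).
    exact: mphi.
  by apply/seteqP; split => x /=; rewrite in_itv/= andbT.
have hC (i : nat) : exists C, [/\ closed C, C `<=` ~` B i,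
    exists r : R, forall x, C x -> `|x| <= r &
    (P (U @^-1` (~` B i `\` C)) < ((2 ^ i.+1)%:R^-1)%:E)%E].
  have [||C cC [CB Cr Ce]] := @inner_regular _ _ (law mU) (~` B i) (2 ^ i.+1)%:R^-1.
  - exact: measurableC.
  - by rewrite invr_gt0 ltr0n expn_gt0.
  by exists C.
have {hC}/choice[C hC] := hC.
have cC i : closed (C i) by case: (hC i).
have CB i : C i `<=` ~` B i by case: (hC i).
pose v := staircase s C.
have vBL k : bounded_lipschitz (v k) by exact: staircase_bounded_lipschitz.
have v0 k x : 0 <= v k x by exact: staircase_ge0.
pose E i := ~` B i `\` C i.
have mE i : measurable (U @^-1` (E i)).
  rewrite -[X in measurable X]setTI; apply: mU => //.
  by apply: measurableD; [exact: measurableC|exact: measurable_closed].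
(* on a layer the plateau is at most 1; off the layer it vanishes on C i, so
   that the only error comes from E i *)
have v_le k w : v k (U w) <=
    phi (U w) + (s + \sum_(i < k) s * \1_(U @^-1` (E i)) w).
  rewrite addrA (le_trans _ (lerD (sum_indicator_levels_le s0 k (phi0 (U w))) (lexx _)))//.
  rewrite -big_split/=; apply: ler_sum => i _; rewrite -mulrDr ler_wpM2l ?(ltW s0)//.
  have [Ci|nCi] := pselect (C i (U w)).
    by rewrite plateau_eq0// addr_ge0// ler0n.
  case: ltP => Bi; first by rewrite (le_trans (plateau_le1 _ _ _ _))// lerDl ler0n.
  rewrite add0r indicE mem_set ?plateau_le1//; split => //=.
  by rewrite /B /= ltNge Bi.
have mterm i : measurable_fun [set: T] (fun w => (s * \1_(U @^-1` (E i)) w)%:E).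
  by apply/measurable_EFinP; apply: measurable_funM => //; exact: measurable_indic.
have term0 i w : (0 <= (s * \1_(U @^-1` (E i)) w)%:E)%E.
  by rewrite lee_fin mulr_ge0// ltW.
have Iv k : \int[P]_w v k (U w) <= I + (s + s).
  have mv : measurable_fun [set: T] (fun w => v k (U w)).
    by apply: measurableT_comp mU; exact: bounded_lipschitz_measurable.
  have iv : P.-integrable [set: T] (EFin \o (fun w => v k (U w))).
    have [_ [M [_ vM _]]] := vBL k; exact: (bounded_integrable P mv (fun w => vM _)).
  rewrite -lee_fin -(expectation_Rintegral iv) unlock.
  apply: (@le_trans _ _ (\int[P]_w ((phi (U w))%:E + (s%:E +
      \sum_(i < k) (s * \1_(U @^-1` (E i)) w)%:E)))%E).
    apply: ge0_le_integral => //.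
    + by move=> w _; rewrite lee_fin.
    + exact/measurable_EFinP.
    + apply: emeasurable_funD; first exact/measurable_EFinP/measurableT_comp.
      apply: emeasurable_funD; first exact: measurable_cst.
      by apply: emeasurable_sum => i; exact: mterm.
    + by move=> w _; rewrite sumEFin -!EFinD lee_fin.
  rewrite ge0_integralD//; last first.
  - apply: emeasurable_funD; first exact: measurable_cst.
    by apply: emeasurable_sum => i; exact: mterm.
  - move=> w _; rewrite adde_ge0 ?lee_fin ?(ltW s0)//.
    by apply: sume_ge0 => i _; exact: term0.
  - exact/measurable_EFinP/measurableT_comp.
  - by move=> w _; rewrite lee_fin.
  rewrite ge0_integralD//; last first.
  - by apply: emeasurable_sum => i; exact: mterm.
  - by move=> w _; apply: sume_ge0 => i _; exact: term0.
  - by move=> w _; rewrite lee_fin ltW.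
  rewrite IE !EFinD leeD2l// integral_cst//= probability_setT mule1 leeD2l//.
  rewrite ge0_integral_sum//.
  apply: (@le_trans _ _ (\sum_(i < k) (s * (2 ^ i.+1)%:R^-1)%:E)%E).
    apply: lee_sum => i _; under eq_integral do rewrite EFinM.
    rewrite ge0_integralZl_EFin ?(ltW s0)//; last first.
      by apply/measurable_EFinP; exact: measurable_indic.
    rewrite integral_indic// setIT EFinM; apply: lee_wpmul2l.
      by rewrite lee_fin ltW.
    by apply/ltW; case: (hC i).
  rewrite sumEFin lee_fin -mulr_sumr sum_half_powers.
  by rewrite ler_piMr ?(ltW s0)// lerBlDr lerDl.
pose c := I + (s + s) + s.
have avg_le k : exists a, avg P (v k) V a <= c.
  have [a ha] := avg_almost_le (vBL k) s0; exists a.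
  by rewrite (le_trans ha)// lerD2r.
have {avg_le}/choice[a ha] := avg_le.
have iv k b : P.-integrable [set: T] (EFin \o (fun w => v k (b + V w))).
  exact: bounded_lipschitz_integrable.
have avg_mono k l b : (k <= l)%N -> avg P (v k) V b <= avg P (v l) V b.
  by move=> kl; apply: le_Rintegral => // w _; exact: staircase_mono.
have I0 : 0 <= I by rewrite fine_ge0// integral_ge0// => w _; rewrite lee_fin.
have c0 : 0 <= c by rewrite !addr_ge0// ltW.
(* v k0 equals s * k0 far from the sets C i with i < k0, so this choice of k0
   makes the average exceed c as soon as half of the mass of b + V is there. *)
pose k0 := (Num.truncn (2 * c / s)).+1.
have k0c : c < s *+ k0 * 2^-1.
  rewrite ltr_pdivlMr// mulrC -[s *+ _]mulr_natr [ltRHS]mulrC -ltr_pdivrMr//.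
  exact: truncnS_gt.
have [rho hrho] : exists rho : R, forall i x, (i < k0)%N -> C i x -> `|x| <= rho.
  elim: k0 {k0c} => [|k [rho hrho]]; first by exists 0.
  have [_ _ [r hr] _] := hC k.
  exists (Num.max rho r) => i x; rewrite ltnS leq_eqVlt le_max.
  by case/predU1P => [->|ik] Cx; [rewrite hr ?orbT|rewrite (hrho _ _ ik)].
have half0 : 0 < 2^-1 :> R by rewrite invr_gt0.
have [K cK [_ [r hr] Kr]] := @inner_regular _ _ (law mV) _ _ measurableT half0.
have mK : measurable (V @^-1` K).
  by rewrite -[X in measurable X]setTI; apply: mV => //; exact: measurable_closed.
have PK : 2^-1 <= fine (P (V @^-1` K)).
  move: Kr; rewrite setTD => Kr.
  have {}Kr : (P (~` (V @^-1` K)) < (2^-1)%:E)%E by exact: Kr.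
  move: Kr; rewrite probability_setC// -[P _]fineK ?fin_num_measure//.
  rewrite -EFinB lte_fin => Kr; lra.
have coercive b : avg P (v k0) V b <= c -> `|b| <= rho + 1 + r.
  move=> bc; rewrite leNgt; apply/negP => blarge; move: bc.
  apply/negP; rewrite -ltNge (lt_le_trans k0c)//.
  have i1 : P.-integrable [set: T] (EFin \o (\1_(V @^-1` K) : T -> R)).
    apply: (@bounded_integrable _ _ _ _ _ 1); first exact: measurable_indic.
    by move=> w; rewrite indicE; case: (_ \in _); rewrite ?normr1 ?normr0.
  apply: (@le_trans _ _ (\int[P]_w (s *+ k0 * \1_(V @^-1` K) w))).
    rewrite RintegralZl//.
    rewrite /Rintegral integral_indic// setIT ler_wpM2l//.
    by rewrite mulrn_wge0// ltW.
  apply: le_Rintegral => //.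
    exact: (integrableZl measurableT (s *+ k0) i1).
  move=> w _; rewrite indicE; case: (boolP (w \in _)); last by rewrite mulr0.
  rewrite inE /= => Kw; rewrite mulr1 /v staircase_eq// => i y ik Ciy.
  have yr := hrho _ _ ik Ciy; have Vr := hr _ Kw.
  have : `|b| <= `|b + V w - y| + `|y| + `|V w|.
    rewrite -{1}(addrK (V w) b) (le_trans (ler_normB _ _))// lerD2r.
    by rewrite -{1}(subrK y (b + V w)) ler_normD.
  lra.
have [b hb] : exists b, forall k, avg P (v k) V b <= c.
  have cpt : compact [set b : 'rV[R]_n | `|b| <= rho + 1 + r].
    apply: bounded_closed_compact.
      exists (rho + 1 + r); split; first exact: num_real.
      by move=> M hM x /= hx; rewrite (le_trans hx)// ltW.
    apply: (@closed_comp _ _ (fun x : 'rV[R]_n => `|x|) [set t | t <= rho + 1 + r]).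
      by move=> x _; exact: norm_continuous.
    exact: closed_le.
  (* any cluster point of the near-optimal translations works *)
  have [|b [_ clb]] := cpt (a @ \oo) _.
    exists k0 => // k /= k0k; apply: coercive.
    by rewrite (le_trans (avg_mono _ _ _ k0k)).
  exists b => k.
  have clk : closed [set x | avg P (v k) V x <= c].
    apply: (@closed_comp _ _ (avg P (v k) V) [set t | t <= c]).
      move=> x _; apply: bounded_lipschitz_continuous.
      exact: avg_bounded_lipschitz.
    exact: closed_le.
  apply: clk; move: clb; rewrite clusterE; apply.
  exists k => // l /= kl; rewrite (le_trans (avg_mono _ _ _ kl))//.
exists b.
have mv k : measurable_fun [set: T] (fun w => (v k (b + V w))%:E).
  by apply/measurable_EFinP/measurable_fun_shift => //; exact: bounded_lipschitz_measurable.
have ndv w k l : (k <= l)%N -> ((v k (b + V w))%:E <= (v l (b + V w))%:E)%E.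
  by move=> kl; rewrite lee_fin; exact: staircase_mono.
have cvv w : (v k (b + V w))%:E @[k --> \oo] --> limn (fun k => (v k (b + V w))%:E).
  by apply: ereal_nondecreasing_is_cvgn => k l; exact: ndv.
apply: (@le_trans _ _ (\int[P]_w limn (fun k => (v k (b + V w))%:E))%E).
  apply: ge0_le_integral => //.
  - by move=> w _; rewrite lee_fin.
  - exact/measurable_EFinP/measurable_fun_shift.
  - by apply: (emeasurable_fun_cvg _ _ mv) => w _; exact: cvv.
  - move=> w _; set x := b + V w.
    have exN : exists N, phi x <= s * N%:R.
      exists (Num.truncn (phi x / s)).+1.
      by rewrite mulrC -ler_pdivrMr// ltW// truncnS_gt.
    (* minimality puts x in the N layers below phi x *)
    case: (ex_minnP exN) => N hN minN.
    have [|k hk] := @staircase_eventually_ge _ _ _ _ s0 cC N x.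
      move=> i iN /CB; apply; rewrite /B /= ltNge; apply/negP => /minN.
      by rewrite leqNgt iN.
    apply: (@le_trans _ _ (v k x)%:E).
      by rewrite lee_fin (le_trans hN)// mulr_natr.
    apply: lime_ge; first by apply/cvg_ex; eexists; exact: (cvv w).
    by exists k => // l /= kl; exact: ndv.
rewrite monotone_convergence//; last 2 first.
- by move=> k w _; rewrite lee_fin.
- by move=> w _ k l; exact: ndv.
rewrite IE -EFinD; apply: lime_le.
  apply: ereal_nondecreasing_is_cvgn => k l kl; apply: ge0_le_integral => //.
  - by move=> w _; rewrite lee_fin.
  - by move=> w _; exact: ndv.
apply: nearW => k; have := expectation_Rintegral (iv k b); rewrite unlock => ->.
by rewrite lee_fin (le_trans (hb k))// /c -ess !addrA.
Qed.

End transfer.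

Section payoff_transfer.
Context d (T : measurableType d) (R : realType) (P : probability T R) (n : nat).
Implicit Types (U V : T -> 'rV[R]_n) (f h : 'rV[R]_n -> R).

Lemma sup_expected_shift f U (a : 'rV[R]_n) :
  (sup_expected P f (fun w => a + U w)%R <= sup_expected P f U)%E.
Proof.
apply: ge_ereal_sup => _ [b _ <-]; apply: ereal_sup_ubound.
by exists (b + a) => //; congr expectation; apply/funext => w; rewrite addrA.
Qed.

(** Bounded above, [Z] has an integrable positive part, so only its negative
    part can fail to be integrable. *)
Lemma expectation_Ny_or_integrable (Z : T -> R) (M : R) :
  measurable_fun [set: T] Z -> (forall w, Z w <= M) ->
  'E_P[Z]%E = -oo%E \/ P.-integrable [set: T] (EFin \o Z).
Proof.
move=> mZ ZM; have [|Zfin] := pselect ('E_P[Z] = -oo)%E; [by left|right].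
have mEZ : measurable_fun [set: T] (EFin \o Z) by exact/measurable_EFinP.
have pos_fin : (\int[P]_w ((EFin \o Z)^\+ w) < +oo)%E.
  apply: (@le_lt_trans _ _ (\int[P]_w (cst (Num.max M 0)%:E w))%E).
    apply: ge0_le_integral => //.
    - exact: measurable_funepos.
    - by move=> w _; rewrite funeposE /= -EFin_max lee_fin; apply: le_max2.
  by rewrite integral_cst//= probability_setT mule1 ltry.
have neg_fin : (\int[P]_w ((EFin \o Z)^\- w) < +oo)%E.
  rewrite ltey; apply/eqP => negy; apply: Zfin.
  by rewrite unlock integralE negy addeNy// ltey_eq.
apply/integrableP; split => //.
rewrite -[fun x => _]/(abse \o (EFin \o Z)) fune_abse ge0_integralD//.
- exact: lte_add_pinfty.
- exact: measurable_funepos.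
- exact: measurable_funeneg.
Qed.

(** A translation of [U] is absorbed in [U]; a payoff with expectation
    -oo there gives nothing to prove, and otherwise the cost [M - f] has a
    finite expectation. *)
Lemma sup_expected_transfer U V f :
  measurable_fun [set: T] U -> measurable_fun [set: T] V ->
  (forall h, bounded_lipschitz h ->
    (sup_expected P h U <= sup_expected P h V)%E) ->
  payoff f -> (sup_expected P f U <= sup_expected P f V)%E.
Proof.
move=> mU mV dom [mf [M fM]].
pose phi x := M - f x.
have mphi : measurable_fun setT phi by exact: measurable_funB.
have phi0 x : 0 <= phi x by rewrite subr_ge0; apply: fM; exists x.
have icst c : P.-integrable [set: T] (EFin \o (fun=> c)).
  exact: finite_measure_integrable_cst.
have expB (W : T -> 'rV[R]_n) : P.-integrable [set: T] (EFin \o (fun w => f (W w))) ->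
    'E_P[fun w => f (W w)]%E = (M%:E - \int[P]_w (phi (W w))%:E)%E.
  move=> iW.
  have -> : (fun w => f (W w)) = (fun w => M - phi (W w)).
    by apply/funext => w; rewrite /phi subKr.
  rewrite unlock.
  under eq_integral do rewrite EFinB.
  rewrite (integralB _ (icst M) (integrableB _ (icst M) iW))//=.
  by rewrite integral_cst//= probability_setT mule1.
apply: ge_ereal_sup => _ [a _ <-].
pose U' w := a + U w.
have mU' : measurable_fun [set: T] U'.
  by apply: measurable_fun_addv => //; exact: measurable_cst.
have dom' h : bounded_lipschitz h ->
    (sup_expected P h U' <= sup_expected P h V)%E.
  by move=> hL; apply: le_trans (dom h hL); exact: sup_expected_shift.
have fle x : f x <= M by apply: fM; exists x.
have [->|iU] := expectation_Ny_or_integrable (measurableT_comp mf mU') (fun w => fle _).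
  exact: leNye.
rewrite [leLHS](expB U' iU); apply/lee_addgt0Pr => e e0.
have Ifin : (\int[P]_w (phi (U' w))%:E)%E \is a fin_num.
  apply: integrable_fin_num => //.
  exact: integrableB (icst M) iU.
have [|b hb] := transfer_cost mU' mV dom' mphi phi0 _ e0.
  by rewrite ltey_eq Ifin.
have ib : P.-integrable [set: T] (EFin \o (fun w => phi (b + V w))).
  apply/integrableP; split.
    exact/measurable_EFinP/measurable_fun_shift.
  under eq_integral do rewrite /= ger0_norm//.
  by apply: le_lt_trans hb _; rewrite -[X in (X + _)%E]fineK// -EFinD ltry.
have ifb : P.-integrable [set: T] (EFin \o (fun w => f (b + V w))).
  have -> : (fun w => f (b + V w)) = (fun w => M - phi (b + V w)).
    by apply/funext => w; rewrite /phi subKr.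
  exact: integrableB (icst M) ib.
have supb : ('E_P[fun w => f (b + V w)%R] <= sup_expected P f V)%E.
  by apply: ereal_sup_ubound; exists b.
apply: le_trans (leeD2r e%:E supb).
rewrite (expB (fun w => b + V w)%R)//.
have ifin := integrable_fin_num measurableT ib.
move: hb ifin Ifin => /=.
case: (\int[P]_w (phi (b + V w))%:E)%E => // x.
case: (\int[P]_w (phi (U' w))%:E)%E => // y.
by rewrite -!EFinB -!EFinD !lee_fin => hb _ _; lra.
Qed.

End payoff_transfer.

(** * Independence *)

Section independence.
Context d (T : measurableType d) (R : realType) (P : probability T R).

Definition independent_pair d1 d2 (T1 : measurableType d1) (T2 : measurableType d2)
    (U : T -> T1) (Y : T -> T2) : Prop :=
  forall A B, measurable A -> measurable B ->
    P (U @^-1` A `&` Y @^-1` B) = (P (U @^-1` A) * P (Y @^-1` B))%E.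

(** The boxes given by the coordinates other than [j] form a pi-system whose
    elements are independent of [X j], and the sum is measurable for the
    sigma-algebra that they generate. *)
Lemma independent_sum n m (X : 'I_m -> T -> 'rV[R]_n) (c : 'I_m -> R) j :
  (forall i, dart (X i)) -> independent_darts P X ->
  independent_pair (X j) (fun w => \sum_(i | i != j) c i *: X i w).
Proof.
move=> mX indX A B mA mB.
pose J : {set 'I_m} := [set~ j]%SET.
have inJ i : (i \in J) = (i != j) by rewrite !inE.
pose box (C : 'I_m -> set 'rV[R]_n) := \bigcap_(i in [set` J]) (X i @^-1` C i).
pose G := [set E | exists2 C, (forall i, measurable (C i)) & E = box C].
have mpre i C : measurable C -> measurable (X i @^-1` C).
  by move=> mC; rewrite -[X in measurable X]setTI; exact: mX.
have mG : G `<=` measurable.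
  move=> _ [C mC ->]; apply: fin_bigcap_measurable; first exact: finite_finset.
  by move=> i _; exact: mpre.
have GI : setI_closed G.
  move=> _ _ [C mC ->] [D mD ->]; exists (fun i => C i `&` D i).
    by move=> i; exact: measurableI.
  by rewrite /box -bigcapI.
have GT : G setT.
  exists (fun=> setT); first by [].
  by apply/seteqP; split.
have Gj i C : i != j -> measurable C -> G (X i @^-1` C).
  move=> ij mC; exists (fun k => if k == i then C else setT).
    by move=> k; case: ifP.
  apply/seteqP; split => [w Cw k _|w /(_ i)] /=.
    by case: eqVneq => [->|].
  by rewrite eqxx inJ; apply.
have XG i : i != j ->
    measurable_fun [set: g_sigma_algebraType G] (X i : g_sigma_algebraType G -> 'rV[R]_n).
  by move=> ij _ C mC; rewrite setTI; apply: sub_gen_smallest; exact: Gj.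
have YG : <<s G >> ((fun w => \sum_(i | i != j) c i *: X i w) @^-1` B).
  have mY : measurable_fun [set: g_sigma_algebraType G]
      (fun w : g_sigma_algebraType G => \sum_(i | i != j) c i *: X i w).
    by apply: measurable_fun_sumv => i ij; apply: measurable_fun_scalev; exact: XG.
  by have := mY measurableT B mB; rewrite setTI.
have mA' := mpre j A mA.
have PA0 : 0 <= fine (P (X j @^-1` A)) by rewrite fine_ge0.
have PAE : P (X j @^-1` A) = ((NngNum PA0)%:num%:E)%E.
  by rewrite /= fineK// fin_num_measure.
rewrite setIC -[LHS]/(mrestr P mA' _) PAE -[RHS]/(mscale (NngNum PA0) P _).
apply: (g_sigma_algebra_measure_unique G mG (fun=> setT)) YG => //.
- by apply/seteqP; split => // x _; exists 0%N.
- move=> _ [C mC ->]. rewrite /= /mrestr /mscale/= fineK ?fin_num_measure//.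
  pose D i := if i == j then A else C i.
  have mD i : measurable (D i) by rewrite /D; case: ifP.
  have boxD : box D = box C.
    by apply: eq_bigcapr => i; rewrite /= inJ => /negPf ij; rewrite /D ij.
  have -> : box C `&` X j @^-1` A = \bigcap_(i in [set` [set: 'I_m]%SET]) (X i @^-1` D i).
    apply/seteqP; split => [w [Cw Aw] i _|w Dw].
      rewrite /D /=; case: eqVneq => [->//|ij]; apply: (Cw i).
      by rewrite /= inJ.
    split; last by have := Dw j; rewrite /D /= eqxx inE; exact.
    by rewrite -boxD => i _; apply: Dw; rewrite /= inE.
  rewrite (indX [set: 'I_m]%SET D mD) -boxD (indX J D mD).
  rewrite (bigD1 j) ?inE//= {1}/D eqxx; congr (_ * _)%E.
  by apply: eq_bigl => i; rewrite inJ inE.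
- move=> _; rewrite /= /mrestr setTI.
  by rewrite (le_lt_trans (probability_le1 _ _))// ltry.
Qed.

Lemma Rintegral_independent d1 d2 (T1 : measurableType d1) (T2 : measurableType d2)
    (U : T -> T1) (Y : T -> T2) (F : T1 * T2 -> R) (M : R) :
  measurable_fun [set: T] U -> measurable_fun [set: T] Y ->
  independent_pair U Y ->
  measurable_fun [set: T1 * T2] F -> (forall z, `|F z| <= M) ->
  \int[P]_w F (U w, Y w) = \int[P]_w \int[P]_w' F (U w, Y w').
Proof.
move=> mU mY ind mF FM.
have mUY : measurable_fun [set: T] (fun w => (U w, Y w)).
  exact: measurable_fun_pair.
pose lU : probability T1 R := distribution P (mfun_Sub (mem_set mU)).
pose lY : probability T2 R := distribution P (mfun_Sub (mem_set mY)).
pose lUY : probability _ R := distribution P (mfun_Sub (mem_set mUY)).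
have FMint d' (S : measurableType d') (Q : probability S R) (phi : S -> T1 * T2) :
    measurable_fun setT phi -> Q.-integrable setT (EFin \o (F \o phi)).
  move=> mphi; apply: (@bounded_integrable _ _ _ _ _ M) => [|w]; last exact: FM.
  exact: measurableT_comp.
have prodE A : measurable A -> (lU \x lY)%E A = lUY A.
  by move=> mA; exact: product_measure_unique.
have mEF : measurable_fun setT (EFin \o F) by exact/measurable_EFinP.
congr fine.
transitivity (\int[lUY]_z (F z)%:E)%E.
  rewrite [RHS]integral_distribution//.
  exact: (FMint _ _ P _ mUY).
transitivity (\int[lU \x lY]_z (F z)%:E)%E.
  by apply: eq_measure_integral => A mA _; apply/esym; exact: prodE.
have iF : (lU \x lY)%E.-integrable setT (EFin \o F).
  have := @FMint _ _ (lU \x lY)%E (fun z => z) (@measurable_id _ _ _).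
  exact.
rewrite -(integral12_prod_meas1 iF).
have mFx x : measurable_fun setT (fun y => F (x, y)).
  exact: (measurableT_comp mF (measurable_pair1 x)).
have innerE x : (\int[lY]_y (F (x, y))%:E)%E = (\int[P]_w (F (x, Y w)))%:E.
  have iFx : P.-integrable setT (EFin \o (fun w => F (x, Y w))).
    apply: (@bounded_integrable _ _ _ _ _ M) => [|w]; last exact: FM.
    exact: measurableT_comp (mFx x) mY.
  rewrite -expectation_Rintegral// unlock integral_distribution//.
  exact/measurable_EFinP.
have iG := integrable_fubini_F iF.
have GE : fubini_F lY (EFin \o F) = fun x => (\int[P]_w (F (x, Y w)))%:E.
  by apply/funext => x; exact: innerE.
rewrite GE in iG *.
have mG : measurable_fun setT (fun x => (\int[P]_w (F (x, Y w)))%:E).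
  exact: measurable_int iG.
rewrite integral_distribution//.
have mG' : measurable_fun setT (fun x => \int[P]_w F (x, Y w)).
  exact/measurable_EFinP.
apply: (@bounded_integrable _ _ _ _ _ M) => [|w].
  exact: (measurableT_comp mG' mU).
by apply: bounded_Rintegral => //; exact: (measurableT_comp (mFx _) mY).
Qed.

End independence.

(** * Scaling one dart at a time *)

Section scaling.
Context d (T : measurableType d) (R : realType) (P : probability T R) (n : nat).
Implicit Types (U Y : T -> 'rV[R]_n) (f h : 'rV[R]_n -> R).

Lemma reasonable_cst U f c : (forall x, f x = c) -> reasonable P U f.
Proof.
move=> fc s t _ _; apply: ge_ereal_sup => _ [a _ <-].
apply: ereal_sup_ubound; exists a => //.
by congr expectation; apply/funext => w; rewrite !fc.
Qed.

(** No random translation beats the best deterministic point.  This is the case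
    of scale 0, which reasonableness does not cover. *)
Lemma sup_expected_le_cst0 U f M : measurable_fun [set: T] U ->
  measurable_fun [set: 'rV[R]_n] f -> (forall x, `|f x| <= M) ->
  (sup_expected P f U <= sup_expected P f (fun=> 0%R))%E.
Proof.
move=> mU mf fM; set S := sup_expected P f (fun=> 0).
have fS x : ((f x)%:E <= S)%E.
  apply: ereal_sup_ubound; exists x => //=.
  by under eq_fun do rewrite addr0; exact: expectation_cst.
apply: ge_ereal_sup => _ [a _ <-].
have iU : P.-integrable [set: T] (EFin \o (fun w => f (a + U w))).
  by apply: (@bounded_integrable _ _ _ _ _ M) => //; exact: measurable_fun_shift.
move: fS; case: S => [s fS|_|/(_ 0)]; [|exact: leey|by rewrite leeNy_eq].
rewrite expectation_Rintegral// lee_fin.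
have <- : \int[P]_w s = s by rewrite Rintegral_cst//= probability_setT mulr1.
apply: le_Rintegral => //; first exact: finite_measure_integrable_cst.
by move=> w _; rewrite -lee_fin.
Qed.

(** Fubini: an independent summand can be averaged into the payoff. *)
Lemma sup_expected_indep U Y h M t : measurable_fun [set: T] U ->
  measurable_fun [set: T] Y -> independent_pair P U Y ->
  measurable_fun [set: 'rV[R]_n] h -> (forall x, `|h x| <= M) ->
  measurable_fun [set: 'rV[R]_n] (avg P h Y) ->
  sup_expected P h (fun w => t *: U w + Y w) = optimal_payoff P U (avg P h Y) t.
Proof.
move=> mU mY ind mh hM mg; rewrite /optimal_payoff /sup_expected.
congr (ereal_sup _); congr (image _ _); apply/funext => a.
have avgM x : `|avg P h Y x| <= M.
  by apply: bounded_Rintegral => //; exact: measurable_fun_shift.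
rewrite !expectation_Rintegral; last 2 first.
- apply: (@bounded_integrable _ _ _ _ _ M) => //.
  by apply: measurable_fun_shift => //; exact: measurable_fun_scalev.
- apply: (@bounded_integrable _ _ _ _ _ M) => //.
  apply: measurable_fun_shift => //; apply: measurable_fun_addv => //.
  exact: measurable_fun_scalev.
congr EFin.
have mF : measurable_fun setT
    (fun z : 'rV[R]_n * 'rV[R]_n => h (a + (t *: z.1 + z.2))).
  apply: measurable_fun_shift => //; apply: measurable_fun_addv => //.
  exact: measurable_fun_scalev.
rewrite (Rintegral_independent mU mY ind mF (fun=> hM _)).
apply: eq_Rintegral => w _; apply: eq_Rintegral => w' _.
by rewrite /= addrA.
Qed.

Lemma sup_expected_scale_indep U Y h M (s t : R) : measurable_fun [set: T] U ->
  measurable_fun [set: T] Y -> independent_pair P U Y ->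
  measurable_fun [set: 'rV[R]_n] h -> (forall x, `|h x| <= M) ->
  measurable_fun [set: 'rV[R]_n] (avg P h Y) -> reasonable P U (avg P h Y) ->
  0 <= s -> s <= t ->
  (sup_expected P h (fun w => t *: U w + Y w)%R <=
   sup_expected P h (fun w => s *: U w + Y w)%R)%E.
Proof.
move=> mU mY ind mh hM mg rU s0 st.
rewrite !(sup_expected_indep _ mU mY ind mh hM mg).
have [s_gt0|] := ltP 0 s; first exact: rU.
move=> s_le0; have -> : s = 0 by apply/le_anti; rewrite s_le0.
rewrite {2}/optimal_payoff; under [X in (_ <= sup_expected _ _ X)%E]eq_fun do rewrite scale0r.
apply: (sup_expected_le_cst0 (M := M)) => //; first exact: measurable_fun_scalev.
by move=> x; apply: bounded_Rintegral => //; exact: measurable_fun_shift.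
Qed.

(** The scales are changed from [D0] to [d0] one index at a time: [W k] uses
    [d0] for the indices below [k]. *)
Lemma sup_expected_scale_sum m (X : 'I_m -> T -> 'rV[R]_n) h M (d0 D0 : 'I_m -> R) :
  (forall j, dart (X j)) -> independent_darts P X ->
  measurable_fun [set: 'rV[R]_n] h -> (forall x, `|h x| <= M) ->
  (forall j Y, measurable_fun [set: T] Y ->
    measurable_fun [set: 'rV[R]_n] (avg P h Y) /\ reasonable P (X j) (avg P h Y)) ->
  (forall j, 0 <= d0 j) -> (forall j, d0 j <= D0 j) ->
  (sup_expected P h (fun w => \sum_(j < m) D0 j *: X j w)%R <=
   sup_expected P h (fun w => \sum_(j < m) d0 j *: X j w)%R)%E.
Proof.
move=> mX indX mh hM rX d0_ge0 dD.
pose c k (j : 'I_m) := if (j < k)%N then d0 j else D0 j.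
pose W k w := \sum_(j < m) c k j *: X j w.
suff h_le k : (k <= m)%N -> (sup_expected P h (W 0%N) <= sup_expected P h (W k))%E.
  have := h_le m (leqnn m).
  rewrite (_ : W m = fun w => \sum_(j < m) d0 j *: X j w) //.
  by apply/funext => w; apply: eq_bigr => j _; rewrite /c ltn_ord.
elim: k => // k IHk km; apply: (le_trans (IHk (ltnW km))).
pose j := Ordinal km.
pose Y w := \sum_(i | i != j) c k i *: X i w.
have -> : W k = fun w => D0 j *: X j w + Y w.
  by apply/funext => w; rewrite /W (bigD1 j)//= {1}/c ltnn.
have -> : W k.+1 = fun w => d0 j *: X j w + Y w.
  apply/funext => w; rewrite /W (bigD1 j)//= {1}/c ltnS leqnn; congr (_ + _).
  apply: eq_bigr => i ij; rewrite /c ltnS leq_eqVlt.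
  by rewrite -[(i == k :> nat)]/(i == j) (negPf ij).
have mY : measurable_fun [set: T] Y.
  by apply: measurable_fun_sumv => i _; apply: measurable_fun_scalev; exact: mX.
have [mg rg] := rX j Y mY.
apply: (sup_expected_scale_indep (M := M)) => //; first exact: mX.
exact: independent_sum.
Qed.

End scaling.

(** * Payoffs of cosine type *)

Section cosine.
Context d (T : measurableType d) (R : realType) (P : probability T R) (n : nat).

Lemma polar_coordinates (C S : R) : exists rho psi, [/\ 0 <= rho, C = rho * cos psi & S = rho * sin psi].
Proof.
have [CS|CS] := eqVneq (C ^+ 2 + S ^+ 2) 0.
  exists 0, 0; rewrite !mul0r; move/eqP: CS.
  by rewrite paddr_eq0 ?sqr_ge0// !sqrf_eq0 => /andP[/eqP -> /eqP ->].
have [r r0 r2] : exists2 r, 0 < r & r ^+ 2 = C ^+ 2 + S ^+ 2.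
  have CS0 : 0 <= C ^+ 2 + S ^+ 2 by rewrite addr_ge0 ?sqr_ge0.
  exists (Num.sqrt (C ^+ 2 + S ^+ 2)); last by rewrite sqr_sqrtr.
  by rewrite sqrtr_gt0 lt_def CS.
have Cr : -1 <= C / r <= 1.
  rewrite -ler_norml normrM normfV (gtr0_norm r0) ler_pdivrMr// mul1r.
  by rewrite -(ger0_norm (ltW r0)) -ler_sqr ?nnegrE// !real_normK ?num_real// r2 lerDl sqr_ge0.
have sinE : r * sin (acos (C / r)) = `|S|.
  rewrite sin_acos// -{1}(ger0_norm (ltW r0)) -{1}sqrtr_sqr -sqrtrM ?sqr_ge0//.
  rewrite -[RHS]sqrtr_sqr; congr Num.sqrt.
  by rewrite mulrBr mulr1 expr_div_n mulrCA divff ?sqrf_eq0 ?gt_eqF// mulr1 r2 addrAC subrr add0r.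
have cosE : C = r * cos (acos (C / r)) by rewrite acosK ?in_itv// mulrC divfK// gt_eqF.
have [S0|S0] := leP 0 S.
  by exists r, (acos (C / r)); rewrite sinE (ger0_norm S0); split => //; exact: ltW.
exists r, (- acos (C / r)); rewrite cosN sinN mulrN sinE ltr0_norm// opprK.
by split => //; exact: ltW.
Qed.

Lemma measurable_sum_coords : measurable_fun [set: 'rV[R]_n]
  (fun x : 'rV[R]_n => \sum_(j < n) x ord0 j).
Proof. by apply: measurable_sum => j; exact: measurable_coord. Qed.

Lemma measurable_cos_type (f : 'rV[R]_n -> R) : same_type (@cos_sum R n) f ->
  measurable_fun [set: 'rV[R]_n] f.
Proof.
move=> [a [c [b [e [_ _ fE]]]]].
have -> : f = fun x => c * cos_sum (a *: x + b) + e by apply/funext.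
apply: measurable_funD => //; apply: measurable_funM => //.
apply: (measurableT_comp (continuous_measurable_fun (@continuous_cos R))).
apply: (measurableT_comp measurable_sum_coords).
apply: measurable_fun_addv => //; apply: measurable_fun_scalev; exact: measurable_id.
Qed.

Lemma bounded_cos_type (f : 'rV[R]_n -> R) : same_type (@cos_sum R n) f ->
  exists M, forall x, `|f x| <= M.
Proof.
move=> [a [c [b [e [_ c0 fE]]]]]; exists (c + `|e|) => x.
rewrite fE (le_trans (ler_normD _ _))// lerD2r normrM gtr0_norm//.
by rewrite ler_piMr ?(ltW c0)// ler_norml cos_geN1 cos_le1.
Qed.

(** With [rho] and [psi] the polar coordinates of the mean of the unit vector of
    angle [th], averaging [c * cos (A x + th) + e] gives
    [c * rho * cos (A x + psi) + e].  This is constant if [rho = 0], and also in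
    dimension 0, where no translation can produce the phase [psi]. *)
Lemma avg_cos_type (f : 'rV[R]_n -> R) (Y : T -> 'rV[R]_n) :
  same_type (@cos_sum R n) f -> measurable_fun [set: T] Y ->
  same_type (@cos_sum R n) (avg P f Y) \/ exists c, forall x, avg P f Y x = c.
Proof.
move=> [a [c [b [e [a0 c0 fE]]]]] mY.
pose th w := \sum_(j < n) (a *: Y w + b) ord0 j.
have mth : measurable_fun [set: T] th.
  apply: (measurableT_comp measurable_sum_coords).
  by apply: measurable_fun_addv => //; exact: measurable_fun_scalev.
have icos : P.-integrable [set: T] (EFin \o (fun w => cos (th w))).
  apply: (@bounded_integrable _ _ _ _ _ 1).
    exact: (measurableT_comp (continuous_measurable_fun (@continuous_cos R))).
  by move=> w; rewrite ler_norml cos_geN1 cos_le1.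
have isin : P.-integrable [set: T] (EFin \o (fun w => sin (th w))).
  apply: (@bounded_integrable _ _ _ _ _ 1).
    exact: (measurableT_comp (continuous_measurable_fun (@continuous_sin R))).
  by move=> w; rewrite ler_norml sin_geN1 sin_le1.
have [rho [psi [rho0 CE SE]]] := polar_coordinates (\int[P]_w cos (th w)) (\int[P]_w sin (th w)).
pose A (x : 'rV[R]_n) := \sum_(j < n) (a *: x) ord0 j.
have avgE x : avg P f Y x = c * rho * cos (A x + psi) + e.
  transitivity (\int[P]_w (c * cos (A x) * cos (th w) - c * sin (A x) * sin (th w) + e)).
    apply: eq_Rintegral => w _; rewrite fE /cos_sum.
    rewrite (_ : \sum_(j < n) _ = A x + th w); first by rewrite cosD; ring.
    by rewrite -big_split/=; apply: eq_bigr => j _; rewrite !mxE; ring.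
  rewrite RintegralD//; last 2 first.
  - exact: (integrableB measurableT (integrableZl measurableT (c * cos (A x)) icos)
      (integrableZl measurableT (c * sin (A x)) isin)).
  - exact: finite_measure_integrable_cst.
  rewrite RintegralB//; last 2 first.
  - exact: (integrableZl measurableT (c * cos (A x)) icos).
  - exact: (integrableZl measurableT (c * sin (A x)) isin).
  rewrite !RintegralZl// CE SE Rintegral_cst//= probability_setT mulr1 cosD; ring.
have [rhoz|rhon0] := eqVneq rho 0.
  by right; exists e => x; rewrite avgE rhoz mulr0 mul0r add0r.
case: (posnP n) => [nz|n0].
  right; exists (c * rho * cos psi + e) => x; rewrite avgE /A big1 ?add0r// => j.
  by have := ltn_ord j; rewrite {2}nz.
left; exists a, (c * rho), (\row_(j < n) (psi / n%:R)), e; split => //.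
  by rewrite mulr_gt0// lt_def rhon0.
move=> x; rewrite avgE /cos_sum; congr (_ * cos _ + _).
under [RHS]eq_bigr do rewrite mxE.
rewrite big_split/=; congr (_ + _).
under eq_bigr do rewrite mxE.
by rewrite sumr_const card_ord -[psi / _ *+ _]mulr_natr divfK// pnatr_eq0 -lt0n.
Qed.

End cosine.

(** * The five families *)

Lemma bounded_lipschitz_payoff (R : realType) n (h : 'rV[R]_n -> R) : bounded_lipschitz h ->
  [/\ payoff h, bounded_fun h & continuous h].
Proof.
move=> hL; have [_ [M [_ hM _]]] := hL; split.
- split; first exact: bounded_lipschitz_measurable.
  by exists M => _ [x _ <-]; rewrite (le_trans (ler_norm _)).
- exists M; split; first exact: num_real.
  by move=> c Mc x _; rewrite /= (le_trans (hM x))// ltW.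
- exact: bounded_lipschitz_continuous.
Qed.

Theorem theorem1p20 (disp : measure_display) (T : measurableType disp)
    (R : realType) (P : probability T R) (n m : nat)
    (F : set ('rV[R]_n -> R)) (X : 'I_m -> T -> 'rV[R]_n)
    (X_indep : independent_darts P X)
    (X_reasonable : forall j : 'I_m, reasonable_darts P F (X j))
    (F_cases : F = @all_payoffs R n \/
               F = @continuous_payoffs R n \/
               F = @bounded_payoffs R n \/
               F = @bounded_continuous_payoffs R n \/
               F = @cos_type_payoffs R n) :
  (forall d D : 'I_m -> R,
     (forall j : 'I_m, 0 <= d j) -> (forall j : 'I_m, 0 <= D j) ->
     (forall j : 'I_m, d j <= D j) ->
     forall f : 'rV[R]_n -> R, F f ->
       (sup_expected P f (fun w => (\sum_(j < m) d j *: X j w)%R) >=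
        sup_expected P f (fun w => (\sum_(j < m) D j *: X j w)%R))%E) /\
  reasonable_darts P F (fun w => \sum_(j < m) X j w).
Proof.
have mX j : dart (X j) by case: (X_reasonable j).
have rX j f : F f -> reasonable P (X j) f by case: (X_reasonable j) => _; exact.
have msum (c : 'I_m -> R) :
    measurable_fun [set: T] (fun w => \sum_(j < m) c j *: X j w).
  by apply: measurable_fun_sumv => j _; apply: measurable_fun_scalev; exact: mX.
suff scale : forall d D : 'I_m -> R, (forall j, 0 <= d j) ->
    (forall j, d j <= D j) -> forall f, F f ->
    (sup_expected P f (fun w => \sum_(j < m) D j *: X j w)%R <=
     sup_expected P f (fun w => \sum_(j < m) d j *: X j w)%R)%E.
  split=> [d D d0 _ dD f Ff|]; first exact: scale.
  split=> [|f Ff s t s0 st]; first by apply: measurable_fun_sumv => j _; exact: mX.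
  rewrite /optimal_payoff.
  under eq_fun do rewrite scaler_sumr.
  under [X in (_ <= sup_expected _ _ X)%E]eq_fun do rewrite scaler_sumr.
  by apply: (scale (fun=> s) (fun=> t)) => // _; exact: ltW.
move=> d D d0 dD f Ff.
have [Fcos|[Fpayoff FBL]] : F = @cos_type_payoffs R n \/
    (F `<=` @payoff R n) /\ (forall h, bounded_lipschitz h -> F h).
  have BL := @bounded_lipschitz_payoff R n.
  case: F_cases => [->|[->|[->|[->|->]]]]; [right|right|right|right|by left].
  - by split=> // h /BL[].
  - by split=> [h []|h /BL[]].
  - by split=> [h []|h /BL[]].
  - by split=> [h []|h /BL[]].
- have [_ fcos] : @cos_type_payoffs R n f by rewrite -Fcos.
  have [M fM] := bounded_cos_type fcos.
  apply: (sup_expected_scale_sum mX X_indep (measurable_cos_type fcos) fM) => // j Y mY.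
  have [gcos|[c gc]] := avg_cos_type P fcos mY.
    have mg := measurable_cos_type gcos; split => //; apply: rX; rewrite Fcos.
    split => //; split => //; have [M' gM] := bounded_cos_type gcos.
    by exists M' => _ [x _ <-]; rewrite (le_trans (ler_norm _)).
  split; last exact: reasonable_cst gc.
  by rewrite (_ : avg P f Y = cst c)//; apply/funext.
- apply: sup_expected_transfer (Fpayoff f Ff) => // h hL.
  have [_ [M [_ hM _]]] := hL.
  apply: (sup_expected_scale_sum mX X_indep (bounded_lipschitz_measurable hL) hM) => // j Y mY.
  have gL := avg_bounded_lipschitz P hL mY.
  by split; [exact: bounded_lipschitz_measurable|exact/rX/FBL].
Qed.
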